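(* Let $k_1,k_2$ be positive integers and let $\mathcal{S}_1,\mathcal{S}_2$ be numerical semigroups, with $\mathcal{S}_1+\mathcal{S}_2=\{s_1+s_2: s_1\in\mathcal{S}_1, s_2\in\mathcal{S}_2\}$. (1) If $\mathcal{S}_1$ is $k_1$-normalescent and $\mathcal{S}_2$ is $k_2$-normalescent, then $\mathcal{S}_1+\mathcal{S}_2$ is $(k_1+k_2)$-normalescent. (2) If $\mathcal{S}_1$ is $k_1$-ray-normalescent and $\mathcal{S}_2$ is $k_2$-ray-normalescent, then $\mathcal{S}_1+\mathcal{S}_2$ is $(k_1+k_2)$-ray-normalescent. (3) In particular, if $\mathcal{S}_1$ is a $k_1$-quotient and $\mathcal{S}_2$ is a $k_2$-quotient, then $\mathcal{S}_1+\mathcal{S}_2$ is a $(k_1+k_2)$-quotient.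
   Context: Let $\mathbb{N}=\{0,1,2,\dots\}$. A numerical semigroup is a set $\mathcal{S}\subseteq\mathbb{N}$ that contains $0$ and is closed under addition (it is not required that $\gcd(\mathcal{S})=1$). For positive integers $a_1,\dots,a_k$, $\langle a_1,\dots,a_k\rangle=\{a_1x_1+\cdots+a_kx_k : x_i\in\mathbb{N}\}$. For a numerical semigroup $\mathcal{T}$ and a positive integer $d$, the quotient is $\mathcal{T}/d=\{t\in\mathbb{N}: dt\in\mathcal{T}\}$. A numerical semigroup $\mathcal{S}$ is a $k$-quotient if $\mathcal{S}=\langle a_1,\dots,a_k\rangle/d$ for some positive integers $d,a_1,\dots,a_k$ (the $a_i$ need not be distinct or form a minimal generating set). A rational polyhedral cone in $\mathbb{R}^m$ is a pointed (containing no line) set of the form $\operatorname{cone}(\mathbf{v}_1,\dots,\mathbf{v}_\ell)=\{\sum_i\lambda_i\mathbf{v}_i:\lambda_i\in\mathbb{R}_{\ge 0}\}$ with $\mathbf{v}_i\in\mathbb{Z}^m$. Its dimension is the dimension of its linear span, and its extreme rays are the vectors of a minimal set (unique up to positive scaling) that generates the cone. A numerical semigroup $\mathcal{S}$ is $k$-normalescent (respectively $k$-ray-normalescent) if $\mathcal{S}=\pi(\mathcal{C}\cap\mathbb{Z}^m)$ for some $m$, some rational polyhedral cone $\mathcal{C}\subseteq\mathbb{R}^m$ of dimension $k$ (respectively, with exactly $k$ extreme rays), and some linear map $\pi:\mathbb{R}^m\to\mathbb{R}$ with integer coefficients. *)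

(* Defs.v *)
From HB Require Import structures.
From mathcomp Require Import all_boot all_order all_algebra.
From mathcomp Require Import finmap.
From mathcomp Require Import all_classical all_reals.

Set Implicit Arguments.
Unset Strict Implicit.
Unset Printing Implicit Defensive.

Import Order.TTheory GRing.Theory Num.Theory.
Local Open Scope classical_set_scope.
Local Open Scope ring_scope.

Definition numerical_semigroup (S : set nat) : Prop :=
  S 0%N /\ forall s t : nat, S s -> S t -> S (s + t)%N.

Definition sumset (S1 S2 : set nat) : set nat :=
  [set (s1 + s2)%N | s1 in S1 & s2 in S2].

Definition generated (k : nat) (a : 'I_k -> nat) : set nat :=
  [set n | exists x : 'I_k -> nat, n = (\sum_(i < k) a i * x i)%N].

Definition quotient (T : set nat) (d : nat) : set nat :=
  [set t | T (d * t)%N].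

Definition k_quotient (k : nat) (S : set nat) : Prop :=
  numerical_semigroup S /\
  exists (d : nat) (a : 'I_k -> nat),
    [/\ (0 < d)%N, forall i, (0 < a i)%N & S = quotient (generated a) d].

Definition integer_points (R : realType) (m : nat) : set 'rV[R]_m :=
  [set x | forall i, x ord0 i \is a Num.int].

(* The coefficients are indexed by the vectors themselves; a vector repeated
   in [vs] gets the same coefficient at each occurrence, which yields the same
   set of nonnegative combinations. *)
Definition cone (R : realType) (m : nat) (vs : seq 'rV[R]_m) : set 'rV[R]_m :=
  [set x | exists2 lam : 'rV[R]_m -> R,
     (forall v, 0 <= lam v) & x = \sum_(v <- vs) lam v *: v].

Definition pointed (R : realType) (m : nat) (C : set 'rV[R]_m) : Prop :=
  ~ exists x u : 'rV[R]_m, u != 0 /\ forall t : R, C (x + t *: u).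

Definition rational_polyhedral_cone (R : realType) (m : nat)
    (C : set 'rV[R]_m) : Prop :=
  pointed C /\
  exists vs : seq 'rV[R]_m,
    (forall v, v \in vs -> integer_points v) /\ C = cone vs.

Definition linear_span (R : realType) (m : nat) (C : set 'rV[R]_m) :
    set 'rV[R]_m :=
  [set x | exists (n : nat) (c : 'I_n -> R) (w : 'I_n -> 'rV[R]_m),
     (forall i, C (w i)) /\ x = \sum_(i < n) c i *: w i].

Definition has_dimension (R : realType) (m : nat) (C : set 'rV[R]_m)
    (k : nat) : Prop :=
  exists U : {vspace 'rV[R]_m}, [set` U] = linear_span C /\ \dim U = k.

(* A minimal generating set is unique up to positive scaling, so its cardinal
   does not depend on the choice of [E]. *)
Definition has_extreme_rays (R : realType) (m : nat) (C : set 'rV[R]_m)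
    (k : nat) : Prop :=
  exists E : {fset 'rV[R]_m},
    [/\ C = cone E,
        forall E' : {fset 'rV[R]_m}, (E' `<` E)%fset -> C <> cone E'
      & #|` E|%fset = k].

Definition integer_form (R : realType) (m : nat) (p : 'I_m -> int)
    (x : 'rV[R]_m) : R :=
  \sum_(i < m) (p i)%:~R * x ord0 i.

(* The equality S = pi (C `&` Z^m) is stated in R, along the embedding of the
   natural numbers. *)
Definition is_projection_of (R : realType) (m : nat) (S : set nat)
    (p : 'I_m -> int) (C : set 'rV[R]_m) : Prop :=
  [set s%:R | s in S] = integer_form p @` (C `&` @integer_points R m).

Definition normalescent (R : realType) (k : nat) (S : set nat) : Prop :=
  numerical_semigroup S /\
  exists (m : nat) (C : set 'rV[R]_m) (p : 'I_m -> int),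
    [/\ rational_polyhedral_cone C, has_dimension C k
      & is_projection_of S p C].

Definition ray_normalescent (R : realType) (k : nat) (S : set nat) : Prop :=
  numerical_semigroup S /\
  exists (m : nat) (C : set 'rV[R]_m) (p : 'I_m -> int),
    [/\ rational_polyhedral_cone C, has_extreme_rays C k
      & is_projection_of S p C].

(* Main.v *)
Require Import Defs.
From mathcomp Require Import all_boot all_order all_algebra.
From mathcomp Require Import finmap zify.
From mathcomp Require Import all_classical all_reals.

(** For (1) and (2), [S1 + S2] is the image of the lattice points of [C1 x C2]
under [p1 + p2]; dimensions add up, and the extreme rays of the product are
those of the two factors.

For (3), if [d] and [e] are coprime then [<a>/d + <b>/e] is
[<e a, d b>/(d e)], because [d e t = e A + d B] forces [d %| A] and [e %| B].
It remains to make the denominator of [<a>/d] coprime to a given [N].  After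
removing common factors of [d] and the [a i], one has
[<a>/d = <a i, c a j (j <> i)>/(c d + a i)] for all large [c] coprime to [a i];
if [c] is moreover divisible by the primes of [N] not dividing [a i], the primes
of [N] that divide the new denominator are those dividing both [d] and [a i]. *)

Set Implicit Arguments.
Unset Strict Implicit.
Unset Printing Implicit Defensive.

Import Order.TTheory GRing.Theory Num.Theory.
Local Open Scope classical_set_scope.

Lemma sumset_semigroup (S1 S2 : set nat) :
  numerical_semigroup S1 -> numerical_semigroup S2 ->
  numerical_semigroup (sumset S1 S2).
Proof.
move=> [S10 S1D] [S20 S2D]; split; first by exists 0 => //; exists 0.
move=> _ _ [s1 Ss1 [s2 Ss2 <-]] [t1 St1 [t2 St2 <-]].
by exists (s1 + t1); [exact: S1D|exists (s2 + t2); [exact: S2D|rewrite addnACA]].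
Qed.

(** * Semigroups generated by finitely many integers *)

Section Generated.
Variables (k : nat) (a : 'I_k -> nat).

Lemma generated0 : generated a 0.
Proof. by exists (fun=> 0); rewrite big1 // => i _; rewrite muln0. Qed.

Lemma generatedD m n : generated a m -> generated a n -> generated a (m + n).
Proof.
move=> [x ->] [y ->]; exists (fun i => x i + y i).
by rewrite -big_split; apply: eq_bigr => i _; rewrite mulnDr.
Qed.

Lemma generatedM c n : generated a n -> generated a (c * n).
Proof.
move=> [x ->]; exists (fun i => c * x i).
by rewrite big_distrr; apply: eq_bigr => i _; rewrite mulnCA.
Qed.

Lemma generated_gen i : generated a (a i).
Proof.
exists (fun j => (j == i) : nat); rewrite (bigD1 i) //= eqxx muln1 big1 ?addn0//.
by move=> j /negPf ->; rewrite muln0.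
Qed.

(** Bezout without negative coefficients: the gcd is the gap between two elements of the semigroup.
    Such gaps are combined along the iterated gcd. *)
Lemma generated_gcd_gap :
  exists2 v, generated a v & generated a (v + \big[gcdn/0]_i a i).
Proof.
elim/big_ind: _ => [|g h [v Tv Tvg] [w Tw Twh]|i _].
- by exists 0; rewrite ?addn0; exact: generated0.
- have [->|g_gt0] := posnP g; first by rewrite gcd0n; exists w.
  have [p q def_p _] := egcdnP h g_gt0.
  (* Since [p * g = q * h + gcdn g h], adding the gcd to this witness gives
     [p * (v + g) + q * w]. *)
  exists (p * v + q * (w + h)); first by apply: generatedD; exact: generatedM.
  rewrite (_ : _ + _ = p * (v + g) + q * w); last by rewrite !mulnDr def_p; lia.
  by apply: generatedD; exact: generatedM.
- by exists 0; [exact: generated0 | exact: generated_gen].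
Qed.

(** Let [v = v' * g] and [v + g] be generated. Writing [n = n' * g] and [n' = q * v' + r] with
    [r < v'], one gets [n = (q - r) * v + r * (v + g)], where [r <= q] as soon as
    [v' * v' <= n']. *)
Lemma generated_cofinite :
  exists B, forall n, B <= n -> \big[gcdn/0]_i a i %| n -> generated a n.
Proof.
have [v Tv Tvg] := generated_gcd_gap; set g := \big[gcdn/0]_i a i in Tvg *.
have gv : g %| v.
  have [x ->] := Tv; apply: dvdn_sum => i _; apply: dvdn_mulr.
  by rewrite /g (bigD1 i) //= dvdn_gcdl.
have [v' def_v] := dvdnP gv; exists (v' * v' * g) => n le_n /dvdnP[n' def_n].
have [g0|g_gt0] := posnP g; first by rewrite def_n g0 muln0; exact: generated0.
(* If [v = 0], then [g] itself is generated. *)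
have [v'0|v'_gt0] := posnP v'.
  by rewrite def_n; apply: generatedM; rewrite def_v v'0 in Tvg.
have le_n' : v' * v' <= n' by rewrite def_n leq_pmul2r in le_n.
have le_q : v' <= n' %/ v' by rewrite leq_divRL.
have lt_r : n' %% v' < v' by rewrite ltn_mod.
rewrite (_ : n = (n' %/ v' - n' %% v') * v + (n' %% v') * (v + g)).
  by apply: generatedD; exact: generatedM.
rewrite mulnDr addnA -mulnDl subnK; last by lia.
by rewrite def_n def_v mulnA -mulnDl -divn_eq.
Qed.

End Generated.

(** * Changing the denominator of a quotient *)

(* The facet [0 <= x i] of the lattice cone [{x | d %| a . x}] is replaced by
   [0 <= c * x i + t], with [t] the value of [a . x / d].  This enlarges the
   cone so little that the new values are at least [c], and all large multiples
   of the gcd of the [a j] already belong to [generated a]. *)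
Lemma quotient_perturb k (a : 'I_k -> nat) (d : nat) (i : 'I_k) :
  0 < a i -> 0 < d ->
  exists B, forall c, B <= c -> coprime c (a i) ->
    quotient (generated (fun j => if j == i then a j else c * a j))
      (c * d + a i)
    = quotient (generated a) d.
Proof.
move=> ai_gt0 d_gt0; have [B genB] := generated_cofinite a.
exists B.+1 => c lt_Bc co_c; have c_gt0 : 0 < c by lia.
have sumE (y : 'I_k -> nat) :
    \sum_j (if j == i then a j else c * a j) * y j
    = a i * y i + c * \sum_(j | j != i) a j * y j.
  rewrite (bigD1 i) //= eqxx; congr (_ + _).
  by rewrite big_distrr; apply: eq_bigr => j /negPf ->; rewrite /= mulnA.
apply/seteqP; split => t; rewrite /quotient /=; last first.
  (* Multiply [d * t = a . x] by [c] and add [a i * t]: the coefficient of [a i] becomes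
     [c * x i + t], the others are kept. *)
  move=> [x def_x]; exists (fun j => if j == i then c * x j + t else x j).
  rewrite sumE eqxx mulnDl -mulnA def_x (bigD1 i) //=.
  rewrite [X in _ = _ + c * X](eq_bigr (fun j => a j * x j)); first by nia.
  by move=> j /negPf ->.
move=> [y]; rewrite sumE; set s := \sum_(j | _) _ => def_y.
(* Modulo [c], [def_y] reads [a i * t = a i * y i], so [c] divides [y i - t] by coprimality; the
   quotient is the coefficient of [a i] in [d * t]. *)
have [le_ty|lt_yt] := leqP t (y i).
  have : c %| a i * (y i - t).
    by apply/dvdnP; exists (d * t - s); rewrite mulnBr mulnBl; nia.
  rewrite Gauss_dvdr // => /dvdnP[x def_x].
  exists (fun j => if j == i then x else y j).
  rewrite (bigD1 i) //= eqxx [X in _ + X](_ : _ = s).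
    apply/eqP; rewrite -(eqn_pmul2l c_gt0); apply/eqP.
    have -> : c * (a i * x + s) = a i * (y i - t) + c * s by rewrite def_x; lia.
    by rewrite mulnBr; nia.
  by apply: eq_bigr => j /negPf ->.
(* Now [t - y i = m * c] with [0 < m], so [t] is at least [c] and exceeds [B]. As
   [d * t = s - a i * m] is a multiple of the gcd, it is generated. *)
have : c %| a i * (t - y i).
  by apply/dvdnP; exists (s - d * t); rewrite mulnBr mulnBl; nia.
rewrite Gauss_dvdr // => /dvdnP[m def_m].
have m_gt0 : 0 < m by case: (posnP m) def_m => // ->; lia.
have def_s : s = d * t + a i * m.
  apply/eqP; rewrite -(eqn_pmul2l c_gt0); apply/eqP.
  have -> : c * (d * t + a i * m) = c * (d * t) + a i * (t - y i).
    by rewrite def_m; lia.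
  by rewrite mulnBr; nia.
apply: genB; first by nia.
have dvd_g j : \big[gcdn/0]_i a i %| a j by rewrite (bigD1 j) //= dvdn_gcdl.
have : \big[gcdn/0]_i a i %| s by apply: dvdn_sum => j _; apply: dvdn_mulr.
by rewrite def_s dvdn_addl //; apply: dvdn_mulr.
Qed.

Lemma quotient_common_factor k (a : 'I_k -> nat) (d e : nat) :
  0 < e -> quotient (generated (fun i => e * a i)) (e * d)
           = quotient (generated a) d.
Proof.
move=> e_gt0; apply/seteqP; split => t [x def_x]; exists x.
  apply/eqP; rewrite -(eqn_pmul2l e_gt0) mulnA def_x big_distrr; apply/eqP.
  by apply: eq_bigr => i _ /=; rewrite mulnA.
by rewrite -mulnA def_x big_distrr; apply: eq_bigr => i _ /=; rewrite mulnA.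
Qed.

(** Descent on [d]: a prime dividing [d] and all the [a i] cancels. In the end each prime of the
    denominator misses some generator, at which [quotient_perturb] can be applied. *)
Lemma quotient_reduced k (a : 'I_k -> nat) (d : nat) :
  (forall i, 0 < a i) -> 0 < d ->
  exists (d' : nat) (a' : 'I_k -> nat),
    [/\ 0 < d', forall i, 0 < a' i,
        forall p, prime p -> p %| d' -> exists i, ~~ (p %| a' i)
      & quotient (generated a') d' = quotient (generated a) d].
Proof.
elim/ltn_ind: d a => d IH a a_gt0 d_gt0.
have [red|/existsNP[p /not_implyP[p_pr /not_implyP[pd /forallNP pa]]]] :=
  pselect (forall p, prime p -> p %| d -> exists i, ~~ (p %| a i)).
  by exists d, a.
have def_a i : a i = p * (a i %/ p).
  by rewrite mulnC divnK //; apply/negPn/negP; exact: pa.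
have def_d : d = p * (d %/ p) by rewrite mulnC divnK.
have p_gt0 := prime_gt0 p_pr.
have [||| d' [a' [? ? ? E]]] := IH (d %/ p) _ (fun i => a i %/ p).
- by rewrite ltn_Pdiv // prime_gt1.
- by move=> i; have := a_gt0 i; rewrite {1}def_a muln_gt0 => /andP[].
- by move: d_gt0; rewrite {1}def_d muln_gt0 => /andP[].
exists d', a'; split => //; rewrite E -(quotient_common_factor _ _ p_gt0) -def_d.
by congr (quotient (generated _) _); apply/funext => i; rewrite -def_a.
Qed.

(** Induction on the number of primes of [N] dividing [d]: perturbing at some [a i] not divisible by
    such a prime [p] removes [p] and brings in no other prime of [N]. *)
Lemma quotient_coprime k (a : 'I_k -> nat) (d N : nat) :
  (forall i, 0 < a i) -> 0 < d -> 0 < N ->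
  exists (d' : nat) (a' : 'I_k -> nat),
    [/\ 0 < d', forall i, 0 < a' i, coprime d' N
      & quotient (generated a') d' = quotient (generated a) d].
Proof.
move=> a_gt0 d_gt0 N_gt0.
have [{}d [{}a [{}d_gt0 {}a_gt0 red <-]]] := quotient_reduced a_gt0 d_gt0.
have [n] := ubnP (size [seq p <- primes N | p %| d]).
elim: n d a d_gt0 a_gt0 red => // n IH d a d_gt0 a_gt0 red lt_n.
have [co|/allPn[p]] := boolP (all (fun p => ~~ (p %| d)) (primes N)).
  exists d, a; split => //.
  rewrite coprime_has_primes //; apply/hasPn => p /(allP co).
  by rewrite /= mem_primes => /negPf ->; rewrite !andbF.
rewrite negbK mem_primes => /and3P[p_pr _ pN] pd.
have [i pai] := red p p_pr pd.
have [B quotB] := quotient_perturb (a_gt0 i) d_gt0.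
(* The first factor carries the primes of [N] that do not divide [a i]; the second is 1 modulo [a i]
   and at least [B]. *)
pose c := N`_(\pi(a i)^') * (1 + a i * B).
have co_c : coprime c (a i).
  rewrite coprimeMl coprime_sym coprime_pi' // part_pnat.
  by rewrite /coprime addnC gcdnC mulnC gcdnMDl gcdn1.
have c_prime q : prime q -> q %| N -> ~~ (q %| a i) -> q %| c.
  move=> q_pr qN qai; apply/dvdn_mulr.
  have : q \in primes N`_(\pi(a i)^').
    rewrite primes_part mem_filter !inE !mem_primes q_pr N_gt0 qN (negPf qai).
    by rewrite !andbF.
  by rewrite mem_primes => /and3P[].
have c_co q : prime q -> q %| a i -> ~~ (q %| c).
  by move=> q_pr qai; rewrite -prime_coprime // coprime_sym (coprime_dvdr qai).
have le_Bc : B <= c.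
  rewrite /c -[leqLHS]mul1n leq_mul ?part_gt0 //.
  by apply: leq_trans (leq_addl _ _); rewrite leq_pmull.
have c_gt0 : 0 < c by rewrite muln_gt0 part_gt0.
have d'_gt0 : 0 < c * d + a i by rewrite addn_gt0 a_gt0 orbT.
have dvd_d' q : prime q -> q %| c * d + a i -> q %| a i -> q %| d.
  move=> q_pr + qai; rewrite dvdn_addl // Euclid_dvdM //.
  by rewrite (negPf (c_co q q_pr qai)).
rewrite -(quotB c) //.
apply: IH => //.
- by move=> j; case: eqP => // _; rewrite muln_gt0 c_gt0 a_gt0.
(* Reducedness survives: [i] serves if [q] does not divide [a i]. Otherwise [q] divides [d], and an
   old index [j] still serves because [q] does not divide [c]. *)
- move=> q q_pr qd'.
  have [qai|qai] := boolP (q %| a i); last by exists i; rewrite eqxx.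
  have [j qaj] := red q q_pr (dvd_d' q q_pr qd' qai); exists j.
  by case: eqP => // _; rewrite Euclid_dvdM // negb_or c_co.
- rewrite ltnS in lt_n; apply: leq_trans lt_n.
  have dvdNd' q : q \in primes N -> q %| c * d + a i -> (q %| d) && (q != p).
    rewrite mem_primes => /and3P[q_pr _ qN] qd'.
    have qai : q %| a i.
      apply: contraLR qd' => qai; rewrite dvdn_addr ?qai //.
      by rewrite dvdn_mulr // c_prime.
    by rewrite (dvd_d' q) //=; apply: contraNneq pai => <-.
  have p_mem : p \in primes N by rewrite mem_primes p_pr N_gt0.
  (* The old list of primes contains the new one and also [p], so the count drops. *)
  apply: (uniq_leq_size (s1 := p :: _)) => [|q].
    rewrite cons_uniq filter_uniq ?primes_uniq // andbT mem_filter p_mem andbT.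
    by apply: contraNN (pai) => /(dvdNd' p p_mem)/andP[_]; rewrite eqxx.
  rewrite inE !mem_filter => /predU1P[->|/andP[qd' q_mem]]; first by rewrite pd.
  by rewrite q_mem; case/andP: (dvdNd' q q_mem qd') => ->.
Qed.

Lemma quotient_sumset k1 k2 (a : 'I_k1 -> nat) (b : 'I_k2 -> nat) (d e : nat) :
  0 < d -> 0 < e -> coprime d e ->
  quotient (generated (fun i : 'I_(k1 + k2) =>
      match fintype.split i with inl j => e * a j | inr j => d * b j end))
    (d * e)
  = sumset (quotient (generated a) d) (quotient (generated b) e).
Proof.
move=> d_gt0 e_gt0 co_de; apply/seteqP; split.
  move=> t [x]; rewrite big_split_ord /=.
  rewrite (eq_bigr (fun j => e * (a j * x (lshift k2 j)))); last first.
    by move=> j _; rewrite (unsplitK (inl j)) mulnA.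
  rewrite [X in _ = _ + X](eq_bigr (fun j => d * (b j * x (rshift k1 j))));
    last first.
    by move=> j _; rewrite (unsplitK (inr j)) mulnA.
  rewrite -!big_distrr /=; set A := \sum_(j < k1) _; set B := \sum_(j < k2) _.
  move=> def_t.
  have : d %| e * A.
    by rewrite -(dvdn_addl _ (dvdn_mulr B (dvdnn d))) -def_t -mulnA dvdn_mulr.
  rewrite Gauss_dvdr // => /dvdnP[s def_A].
  have : e %| d * B.
    by rewrite -(dvdn_addr _ (dvdn_mulr A (dvdnn e))) -def_t mulnAC dvdn_mull.
  rewrite Gauss_dvdr 1?coprime_sym // => /dvdnP[r def_B].
  exists s; first by exists (fun j => x (lshift k2 j)); rewrite mulnC -def_A.
  exists r; first by exists (fun j => x (rshift k1 j)); rewrite mulnC -def_B.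
  apply/eqP; have de_gt0 : 0 < d * e by rewrite muln_gt0 d_gt0.
  by rewrite -(eqn_pmul2l de_gt0) def_t def_A def_B; apply/eqP; lia.
move=> _ [s [x def_s] [r [y def_r] <-]].
exists (fun i => match fintype.split i with inl j => x j | inr j => y j end).
rewrite big_split_ord /= mulnDr; congr (_ + _).
  rewrite mulnAC def_s mulnC big_distrr; apply: eq_bigr => j _.
  by rewrite (unsplitK (inl j)) /= mulnA.
rewrite -mulnA def_r big_distrr; apply: eq_bigr => j _.
by rewrite (unsplitK (inr j)) /= mulnA.
Qed.

Lemma k_quotient_sumset k1 k2 (S1 S2 : set nat) :
  k_quotient k1 S1 -> k_quotient k2 S2 -> k_quotient (k1 + k2) (sumset S1 S2).
Proof.
move=> [sg1 [d1 [a1 [d1_gt0 a1_gt0 def1]]]] [sg2 [e [b [e_gt0 b_gt0 def2]]]].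
split; first exact: sumset_semigroup.
(* Only the first denominator is changed, with [N := e]. *)
have [d [a [d_gt0 a_gt0 co_de def_a]]] := quotient_coprime a1_gt0 d1_gt0 e_gt0.
rewrite def1 def2 -def_a -(quotient_sumset _ _ d_gt0 e_gt0 co_de).
eexists; eexists; split; last reflexivity; first by rewrite muln_gt0 d_gt0.
by move=> i /=; case: (fintype.split i) => j;
  rewrite muln_gt0 ?d_gt0 ?e_gt0 ?a_gt0 ?b_gt0.
Qed.

Local Open Scope ring_scope.

(** * Finitely generated cones *)

Section Cone.
Variables (R : realType) (m : nat).
Implicit Types (vs ws : seq 'rV[R]_m) (x v : 'rV[R]_m).

Lemma cone0 vs : cone vs 0.
Proof. by exists (fun=> 0) => //; rewrite big1 // => v _; rewrite scale0r. Qed.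

Lemma coneD vs x y : cone vs x -> cone vs y -> cone vs (x + y).
Proof.
move=> [l l0 ->] [l' l'0 ->]; exists (fun v => l v + l' v).
  by move=> v; rewrite addr_ge0.
by rewrite -big_split; apply: eq_bigr => v _; rewrite scalerDl.
Qed.

Lemma coneZ vs (c : R) x : 0 <= c -> cone vs x -> cone vs (c *: x).
Proof.
move=> c0 [l l0 ->]; exists (fun v => c * l v).
  by move=> v; rewrite mulr_ge0.
by rewrite scaler_sumr; apply: eq_bigr => v _; rewrite scalerA.
Qed.

Lemma mem_cone vs v : v \in vs -> cone vs v.
Proof.
move=> v_vs; pose n : R := (count_mem v vs)%:R.
have n_neq0 : n != 0 by rewrite pnatr_eq0 -lt0n -has_count has_pred1.
(* The coefficient of [v] is counted once per occurrence in [vs], hence the division by the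
   multiplicity [n]. *)
exists (fun u => (u == v)%:R / n) => [u|]; first by rewrite divr_ge0.
rewrite (eq_bigr (fun u => if u == v then n^-1 *: v else 0)) => [|u _].
  rewrite -big_mkcond big_const_seq iter_addr_0 -scaler_nat scalerA.
  by rewrite divff ?scale1r.
by case: eqP => [->|_]; rewrite ?mul1r // mul0r scale0r.
Qed.

(** [cone vs] is the least convex cone containing [vs]; inclusions below are thereby checked on
    generators. *)
Lemma cone_sub vs (K : set 'rV[R]_m) :
  K 0 -> (forall x y, K x -> K y -> K (x + y)) ->
  (forall (c : R) x, 0 <= c -> K x -> K (c *: x)) ->
  (forall v, v \in vs -> K v) -> cone vs `<=` K.
Proof.
move=> K0 KD KZ Kvs _ [l l0 ->]; rewrite big_seq.
by elim/big_ind: _ => // v v_vs; apply: KZ => //; apply: Kvs.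
Qed.

Lemma cone_subset vs ws : {subset vs <= ws} -> cone vs `<=` cone ws.
Proof.
move=> sub; apply: cone_sub => [|x y|c x|v /sub];
  [exact: cone0|exact: coneD|exact: coneZ|exact: mem_cone].
Qed.

Lemma eq_cone vs ws : vs =i ws -> cone vs = cone ws.
Proof. by move=> E; apply/seteqP; split; apply: cone_subset => v; rewrite E. Qed.

Lemma rational_polyhedral_cone0 (C : set 'rV[R]_m) :
  rational_polyhedral_cone C -> C 0.
Proof. by move=> [_ [vs [_ ->]]]; exact: cone0. Qed.

End Cone.

(** * Products of cones *)

Definition prod_cone (R : realType) (m1 m2 : nat) (C1 : set 'rV[R]_m1)
    (C2 : set 'rV[R]_m2) : set 'rV[R]_(m1 + m2) :=
  [set x | C1 (lsubmx x) /\ C2 (rsubmx x)].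

Section Product.
Variables (R : realType) (m1 m2 : nat).
Variables (C1 : set 'rV[R]_m1) (C2 : set 'rV[R]_m2).

(** Padding by zero embeds each factor linearly, and (x, y) = (x, 0) + (0, y). *)
Lemma cone_prod (vs1 : seq 'rV[R]_m1) (vs2 : seq 'rV[R]_m2) :
  cone ([seq row_mx v 0 | v <- vs1] ++ [seq row_mx 0 v | v <- vs2])
  = prod_cone (cone vs1) (cone vs2).
Proof.
apply/seteqP; split.
  apply: cone_sub => [|x y|c x c0|v].
  - by split; rewrite linear0; exact: cone0.
  - by move=> [? ?] [? ?]; split; rewrite linearD; exact: coneD.
  - by move=> [? ?]; split; rewrite linearZ; exact: coneZ.
  - rewrite mem_cat => /orP[] /mapP[u u_vs ->];
      by split; rewrite ?row_mxKl ?row_mxKr;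
        [exact: mem_cone || exact: cone0 | exact: mem_cone || exact: cone0].
set vs := _ ++ _ => x [x1 x2].
have inl u : cone vs1 u -> cone vs (row_mx u 0).
  move: u; apply: cone_sub => [|u v ? ?|c u ? ?|v v_vs].
  - by rewrite row_mx0; exact: cone0.
  - by rewrite -[0]addr0 -add_row_mx; exact: coneD.
  - by rewrite -[0](scaler0 _ c) -scale_row_mx; exact: coneZ.
  - by apply: mem_cone; rewrite mem_cat (map_f (fun w => row_mx w 0)).
have inr u : cone vs2 u -> cone vs (row_mx 0 u).
  move: u; apply: cone_sub => [|u v ? ?|c u ? ?|v v_vs].
  - by rewrite row_mx0; exact: cone0.
  - by rewrite -[0]addr0 -add_row_mx; exact: coneD.
  - by rewrite -[0](scaler0 _ c) -scale_row_mx; exact: coneZ.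
  - by apply: mem_cone; rewrite mem_cat (map_f (row_mx 0)) ?orbT.
rewrite -[x]hsubmxK -[lsubmx x]addr0 -[rsubmx x]add0r -add_row_mx.
by apply: coneD; [exact: inl | exact: inr].
Qed.

(** A nonzero direction has a nonzero component, so a line in the product projects to a line in one
    of the factors. *)
Lemma pointed_prod :
  pointed C1 -> pointed C2 -> pointed (prod_cone C1 C2).
Proof.
move=> P1 P2 [x [u [u0 line]]].
have [lu0|lu0] := eqVneq (lsubmx u) 0; last first.
  apply: P1; exists (lsubmx x), (lsubmx u); split => // t.
  by have [+ _] := line t; rewrite linearD linearZ.
apply: P2; exists (rsubmx x), (rsubmx u); split => [|t].
  by apply: contra_neq u0 => ru0; rewrite -[u]hsubmxK lu0 ru0 row_mx0.
by have [_] := line t; rewrite linearD linearZ.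
Qed.

Lemma integer_points_row_mx (x : 'rV[R]_m1) (y : 'rV[R]_m2) :
  integer_points (row_mx x y) <-> integer_points x /\ integer_points y.
Proof.
split=> [int_xy|[int_x int_y] i].
  split=> i; first by rewrite -(row_mxEl x y); exact: int_xy.
  by rewrite -(row_mxEr x y); exact: int_xy.
by rewrite mxE; case: split_ordP => j _.
Qed.

Lemma rational_cone_prod :
  rational_polyhedral_cone C1 -> rational_polyhedral_cone C2 ->
  rational_polyhedral_cone (prod_cone C1 C2).
Proof.
move=> [P1 [vs1 [int1 def1]]] [P2 [vs2 [int2 def2]]].
split; first exact: pointed_prod.
exists ([seq row_mx v 0 | v <- vs1] ++ [seq row_mx 0 v | v <- vs2]).
split; last by rewrite cone_prod -def1 -def2.
have int0 m : @integer_points R m 0 by move=> i; rewrite mxE rpred0.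
move=> v; rewrite mem_cat => /orP[] /mapP[u u_vs ->].
  by apply/integer_points_row_mx; split => //; exact: int1.
by apply/integer_points_row_mx; split => //; exact: int2.
Qed.

Definition cat_form (p1 : 'I_m1 -> int) (p2 : 'I_m2 -> int)
    (i : 'I_(m1 + m2)) : int :=
  match fintype.split i with inl j => p1 j | inr j => p2 j end.

Lemma integer_form_row_mx p1 p2 (x : 'rV[R]_m1) (y : 'rV[R]_m2) :
  integer_form (cat_form p1 p2) (row_mx x y)
  = integer_form p1 x + integer_form p2 y.
Proof.
rewrite /integer_form big_split_ord; congr (_ + _); apply: eq_bigr => i _.
  by rewrite row_mxEl /cat_form (unsplitK (inl i)).
by rewrite row_mxEr /cat_form (unsplitK (inr i)).
Qed.

Lemma projection_prod p1 p2 (S1 S2 : set nat) :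
  is_projection_of S1 p1 C1 -> is_projection_of S2 p2 C2 ->
  is_projection_of (sumset S1 S2) (cat_form p1 p2) (prod_cone C1 C2).
Proof.
rewrite /is_projection_of => E1 E2; apply/seteqP; split.
  move=> _ [_ [s1 Ss1 [s2 Ss2 <-]] <-].
  have [x [C1x int_x] def_x] :
      (integer_form p1 @` (C1 `&` @integer_points R m1)) s1%:R.
    by rewrite -E1; exists s1.
  have [y [C2y int_y] def_y] :
      (integer_form p2 @` (C2 `&` @integer_points R m2)) s2%:R.
    by rewrite -E2; exists s2.
  exists (row_mx x y).
    by split; [split; rewrite ?row_mxKl ?row_mxKr|apply/integer_points_row_mx].
  by rewrite integer_form_row_mx def_x def_y natrD.
move=> _ [x [[C1x C2x] int_x] <-]; rewrite -[x]hsubmxK in int_x *.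
have [int1 int2] := (integer_points_row_mx _ _).1 int_x.
have [s1 Ss1 def1] : [set s%:R | s in S1] (integer_form p1 (lsubmx x)).
  by rewrite E1; exists (lsubmx x).
have [s2 Ss2 def2] : [set s%:R | s in S2] (integer_form p2 (rsubmx x)).
  by rewrite E2; exists (rsubmx x).
exists (s1 + s2)%N; first by exists s1 => //; exists s2.
by rewrite integer_form_row_mx -def1 -def2 natrD.
Qed.

(** The span of the product is the direct sum of the padded spans. Having 0 in each cone puts the
    padded vectors (w, 0) and (0, w) in the product. *)
Lemma has_dimension_prod k1 k2 : C1 0 -> C2 0 ->
  has_dimension C1 k1 -> has_dimension C2 k2 ->
  has_dimension (prod_cone C1 C2) (k1 + k2).
Proof.
move=> C10 C20 [U1 [span1 dim1]] [U2 [span2 dim2]].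
pose f1 : 'Hom('rV[R]_m1, 'rV[R]_(m1 + m2)) :=
  linfun (mulmxr (row_mx 1%:M 0 : 'M[R]_(m1, m1 + m2))).
pose f2 : 'Hom('rV[R]_m2, 'rV[R]_(m1 + m2)) :=
  linfun (mulmxr (row_mx 0 1%:M : 'M[R]_(m2, m1 + m2))).
have f1E (x : 'rV[R]_m1) : f1 x = row_mx x 0.
  by rewrite lfunE /= mul_mx_row mulmx1 mulmx0.
have f2E (x : 'rV[R]_m2) : f2 x = row_mx 0 x.
  by rewrite lfunE /= mul_mx_row mulmx1 mulmx0.
exists (f1 @: U1 + f2 @: U2)%VS; split; last first.
  rewrite dimv_disjoint_sum; last first.
    apply/eqP; rewrite -subv0; apply/subvP => x.
    move=> /memv_capP[/memv_imgP[u _ ->] /memv_imgP[v _]].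
    by rewrite f1E f2E => /eq_row_mx[u0 _]; rewrite u0 row_mx0 mem0v.
  (* Padding is injective, so it preserves dimensions. *)
  rewrite !limg_dim_eq ?dim1 ?dim2 //.
    apply/eqP; rewrite -subv0; apply/subvP => v /memv_capP[_].
    by rewrite memv_ker f2E -row_mx0 => /eqP/eq_row_mx[_ ->]; rewrite mem0v.
  apply/eqP; rewrite -subv0; apply/subvP => v /memv_capP[_].
  by rewrite memv_ker f1E -row_mx0 => /eqP/eq_row_mx[-> _]; rewrite mem0v.
apply/seteqP; split.
  move=> _ /= /memv_addP[_ /memv_imgP[u uU1 ->] [_ /memv_imgP[v vU2 ->] ->]].
  have [n1 [c1 [w1 [Cw1 def_u]]]] : linear_span C1 u by rewrite -span1.
  have [n2 [c2 [w2 [Cw2 def_v]]]] : linear_span C2 v by rewrite -span2.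
  exists (n1 + n2)%N,
    (fun i => match fintype.split i with inl j => c1 j | inr j => c2 j end),
    (fun i => match fintype.split i with
       inl j => row_mx (w1 j) 0 | inr j => row_mx 0 (w2 j) end).
  split.
    by move=> i; case: (fintype.split i) => j; split;
      rewrite ?row_mxKl ?row_mxKr.
  rewrite big_split_ord def_u def_v !linear_sum; congr (_ + _).
    by apply: eq_bigr => i _; rewrite (unsplitK (inl i)) linearZ /= f1E.
  by apply: eq_bigr => i _; rewrite (unsplitK (inr i)) linearZ /= f2E.
move=> x [n [c [w [Cw def_x]]]] /=.
apply/memv_addP; exists (f1 (lsubmx x)).
  apply: memv_img; suff: [set` U1] (lsubmx x) by [].
  rewrite span1; exists n, c, (fun i => lsubmx (w i)); split.
    by move=> i; case: (Cw i).
  by rewrite def_x linear_sum; apply: eq_bigr => i _; rewrite linearZ.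
exists (f2 (rsubmx x)).
  apply: memv_img; suff: [set` U2] (rsubmx x) by [].
  rewrite span2; exists n, c, (fun i => rsubmx (w i)); split.
    by move=> i; case: (Cw i).
  by rewrite def_x linear_sum; apply: eq_bigr => i _; rewrite linearZ.
by rewrite f1E f2E add_row_mx addr0 add0r hsubmxK.
Qed.

(** Dropping 0 from a generating set does not change the cone. This is what makes the padded copies
    of two minimal sets disjoint, 0 being the only vector they could share. *)
Lemma zero_notin_rays m (E : {fset 'rV[R]_m}) :
  (forall E' : {fset 'rV[R]_m}, (E' `<` E)%fset -> cone E <> cone E') ->
  0 \notin E.
Proof.
move=> minE; apply/negP => E0.
apply: (minE _ (fproperD1 E0)); apply/seteqP; split; last first.
  by apply: cone_subset; exact/fsubsetP/fsubD1set.
apply: cone_sub => [|x y|c x|v vE]; [exact: cone0|exact: coneD|exact: coneZ|].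
have [->|v0] := eqVneq v 0; first exact: cone0.
by apply: mem_cone; rewrite !inE v0.
Qed.

Lemma has_extreme_rays_prod k1 k2 :
  has_extreme_rays C1 k1 -> has_extreme_rays C2 k2 ->
  has_extreme_rays (prod_cone C1 C2) (k1 + k2).
Proof.
move=> [E1 [-> min1 card1]] [E2 [-> min2 card2]].
pose i1 (v : 'rV[R]_m1) := row_mx v (0 : 'rV[R]_m2).
pose i2 (v : 'rV[R]_m2) := row_mx (0 : 'rV[R]_m1) v.
have inj1 : injective i1 by move=> u v /eq_row_mx[].
have inj2 : injective i2 by move=> u v /eq_row_mx[].
pose E := ([fset i1 v | v in E1] `|` [fset i2 v | v in E2])%fset.
have coneE : cone E = prod_cone (cone E1) (cone E2).
  rewrite -cone_prod; apply: eq_cone => v; rewrite inE mem_cat; congr (_ || _).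
    by apply/imfsetP/mapP => -[u ? ->]; exists u.
  by apply/imfsetP/mapP => -[u ? ->]; exists u.
exists E; split.
- by rewrite coneE.
- move=> E' ltE' eqE'.
  have leE' := fproper_sub ltE'.
  (* [E1'] and [E2'] are the generators of each factor whose padded copy survives in [E']. *)
  pose E1' := [fset v in E1 | i1 v \in E']%fset.
  pose E2' := [fset v in E2 | i2 v \in E']%fset.
  have sub1 : (E1' `<=` E1)%fset by exact: fset_sub.
  have sub2 : (E2' `<=` E2)%fset by exact: fset_sub.
  have subE' : cone E' `<=` prod_cone (cone E1') (cone E2').
    rewrite -cone_prod; apply: cone_subset => v vE'.
    have := fsubsetP leE' _ vE'; rewrite inE mem_cat.
    move=> /orP[] /imfsetP[u /= uE def_v]; apply/orP; [left|right].
      by apply/mapP; exists u; rewrite // !inE uE -def_v.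
    by apply/mapP; exists u; rewrite // !inE uE -def_v.
  (* The point (x, 0) lies in [cone E'], and the first component of any point there is generated by
     [E1']. *)
  have le1 : cone E1 `<=` cone E1'.
    move=> x xE1; have : cone E' (i1 x).
      by rewrite -eqE'; split; rewrite ?row_mxKl ?row_mxKr //; exact: cone0.
    by move=> /subE'[]; rewrite row_mxKl.
  have le2 : cone E2 `<=` cone E2'.
    move=> x xE2; have : cone E' (i2 x).
      by rewrite -eqE'; split; rewrite ?row_mxKl ?row_mxKr //; exact: cone0.
    by move=> /subE'[_]; rewrite row_mxKr.
  (* A proper subset [E1'] would still generate [cone E1], against the minimality of [E1]. *)
  have eqE1 : E1' = E1.
    apply/eqP; move: sub1; rewrite fsubEproper => /orP[//|/[dup] lt1 /min1[]].
    by apply/seteqP; split => //; exact/cone_subset/fsubsetP/fproper_sub.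
  have eqE2 : E2' = E2.
    apply/eqP; move: sub2; rewrite fsubEproper => /orP[//|/[dup] lt2 /min2[]].
    by apply/seteqP; split => //; exact/cone_subset/fsubsetP/fproper_sub.
  (* No generator of either factor was lost, so [E] is contained in [E'], which is absurd. *)
  have [_ /negP[]] := andP ltE'; apply/fsubsetP => v; rewrite inE.
  move=> /orP[] /imfsetP[u /= uE ->].
    by move: uE; rewrite -eqE1 !inE => /andP[].
  by move: uE; rewrite -eqE2 !inE => /andP[].
- rewrite cardfsU disjoint_fsetI0; last first.
    apply/fdisjointP => _ /imfsetP[u /= uE1 ->]; apply/negP.
    move=> /imfsetP[w /= _ /eq_row_mx[u0 _]].
    by have /negP := zero_notin_rays min1; rewrite -u0.
  by rewrite cardfs0 subn0 !card_imfset ?card1 ?card2.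
Qed.

End Product.

Theorem theorem1p7 (R : realType) (k1 k2 : nat) (S1 S2 : set nat)
    (hk1 : (0 < k1)%N) (hk2 : (0 < k2)%N)
    (hS1 : numerical_semigroup S1) (hS2 : numerical_semigroup S2) :
  [/\ normalescent R k1 S1 -> normalescent R k2 S2 ->
        normalescent R (k1 + k2)%N (sumset S1 S2),
      ray_normalescent R k1 S1 -> ray_normalescent R k2 S2 ->
        ray_normalescent R (k1 + k2)%N (sumset S1 S2)
    & k_quotient k1 S1 -> k_quotient k2 S2 ->
        k_quotient (k1 + k2)%N (sumset S1 S2)].
Proof.
split; last exact: k_quotient_sumset.
  move=> [_ [m1 [C1 [p1 [rat1 dim1 proj1]]]]] [_ [m2 [C2 [p2 [rat2 dim2 proj2]]]]].
  split; first exact: sumset_semigroup.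
  exists (m1 + m2)%N, (prod_cone C1 C2), (cat_form p1 p2); split.
  - exact: rational_cone_prod.
  - by apply: has_dimension_prod => //; exact: rational_polyhedral_cone0.
  - exact: projection_prod.
move=> [_ [m1 [C1 [p1 [rat1 ray1 proj1]]]]] [_ [m2 [C2 [p2 [rat2 ray2 proj2]]]]].
split; first exact: sumset_semigroup.
exists (m1 + m2)%N, (prod_cone C1 C2), (cat_form p1 p2); split.
- exact: rational_cone_prod.
- exact: has_extreme_rays_prod.
- exact: projection_prod.
Qed.
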